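(* Let $d\ge2$ and $1\le k\le n$ be integers and let $\epsilon\ge0$. Put $$\Delta:=\frac{d^k+d^{n-k}}{d^n+1}-\frac1{d^k},\qquad \delta:=\epsilon^2-\Delta,$$ and assume $\epsilon^2\ge2\Delta$. Then a Haar random pure state $|\psi\rangle\in(\mathbb C^d)^{\otimes n}$ is an $\epsilon$-approximate $k$-uniform state with probability at least $$1-\binom nk\,2\exp\left(-\frac{d^n\delta^2}{72\pi^3\log2}\right).$$
   Context: For a pure state $|\psi\rangle\in(\mathbb C^d)^{\otimes n}$ and $S\subseteq[n]=\{1,\dots,n\}$, put $\rho=|\psi\rangle\langle\psi|$, $\rho_S=\mathrm{Tr}_{S^c}\rho$, $d_S=d^{|S|}$. The state is an $\epsilon$-approximate $k$-uniform state if $\mathrm{Tr}\,\rho_S^2\le\frac1{d_S}+\epsilon^2$ for every $S\subseteq[n]$ with $|S|=k$. A Haar random state is a unit vector distributed according to the unitarily invariant probability measure on the unit sphere. $\log$ is the natural logarithm. *)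

(* Defs.v *)
(* MathComp / MathComp-Analysis. *)
From HB Require Import structures.
From mathcomp Require Import all_boot all_order all_algebra.
From mathcomp Require Import all_classical all_reals all_analysis.
From mathcomp Require Import complex.
Set Implicit Arguments.
Unset Strict Implicit.
Unset Printing Implicit Defensive.
Import Order.TTheory GRing.Theory Num.Theory.
Import numFieldNormedType.Exports.
Local Open Scope classical_set_scope.
Local Open Scope ring_scope.
Local Open Scope sesquilinear_scope.

(* R[i], packaged so that matrices over it get their topology from the
   modulus. *)
Definition Cplx (R : realType) : numClosedFieldType := R[i].

(* The computational basis of (C^d)^{(x) n} is indexed by the functions
   {0..n-1} -> {0..d-1}; dimension #|comp_basis d n| is d ^ n (card_comp_basis).
   Matrix indices go through enum_rank / enum_val. *)
Definition comp_basis (d n : nat) : finType := {ffun 'I_n -> 'I_d}.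

Lemma card_comp_basis (d n : nat) : #|comp_basis d n| = (d ^ n)%N.
Proof. by rewrite card_ffun !card_ord. Qed.

Definition ket (R : realType) (d n : nat) := 'cV[Cplx R]_#|comp_basis d n|.

(* The same space with its Borel sigma-algebra. *)
Definition borel_ket (R : realType) (d n : nat) :=
  g_sigma_algebraType (@open (ket R d n)).
HB.instance Definition _ (R : realType) (d n : nat) :=
  Measurable.on (borel_ket R d n).

Definition unit_sphere (R : realType) (d n : nat) : set (ket R d n) :=
  [set psi | psi ^t* *m psi = 1%:M].

(* The unitarily invariant probability measure on the unit sphere, viewed as
   a Borel measure on the ambient space that gives the sphere full mass. *)
Definition haar_state (R : realType) (d n : nat)
    (mu : probability (borel_ket R d n) R) : Prop :=
  mu (@unit_sphere R d n) = 1%E /\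
  forall U : 'M[Cplx R]_#|comp_basis d n|, U \is unitarymx ->
  forall A : set (borel_ket R d n), measurable A ->
    mu [set psi | A (U *m psi)] = mu A.

Definition density (R : realType) (d n : nat) (psi : ket R d n) :
  'M[Cplx R]_#|comp_basis d n| := psi *m psi ^t*.

(* Basis of the tensor factors in S, and of those outside S. *)
Definition sub_basis (d n : nat) (S : {set 'I_n}) : finType :=
  {ffun {i : 'I_n | i \in S} -> 'I_d}.
Definition env_basis (d n : nat) (S : {set 'I_n}) : finType :=
  {ffun {i : 'I_n | i \notin S} -> 'I_d}.

(* |a>_S |c>_{S^c} as an element of the full basis. *)
Definition glue_basis (d n : nat) (S : {set 'I_n})
    (a : sub_basis d S) (c : env_basis d S) : comp_basis d n :=
  [ffun i => match boolP (i \in S) with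
             | AltTrue iS => a (exist _ i iS)
             | AltFalse iNS => c (exist _ i iNS)
             end].

(* Partial trace over S^c: <a| rho_S |b> = \sum_c <a,c| rho |b,c>. *)
Definition reduced (R : realType) (d n : nat) (S : {set 'I_n})
    (rho : 'M[Cplx R]_#|comp_basis d n|) : 'M[Cplx R]_#|sub_basis d S| :=
  \matrix_(a, b) \sum_(c : env_basis d S)
    rho (enum_rank (glue_basis (enum_val a) c)) (enum_rank (glue_basis (enum_val b) c)).

(* The inequality is in R[i], so it also asserts that the purity is real,
   which always holds. *)
Definition approx_kuniform (R : realType) (d n k : nat) (eps : R)
    (psi : ket R d n) : Prop :=
  unit_sphere psi /\
  forall S : {set 'I_n}, #|S| = k ->
    let rhoS := reduced S (density psi) in
    \tr (rhoS *m rhoS) <= (((d ^ #|S|)%:R)^-1 + eps ^+ 2)%:C%C :> Cplx R.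

(* Main.v *)
(* Write f(psi) = Tr rho_S^2 and N = d^n.  Unitary invariance of the law of psi
   gives E[D_A F] = 0 for every polynomial F in the amplitudes and every matrix A,
   where D_A is the derivation generated by psi |-> A psi.  The Casimir sum of
   D_qp D_pq over the matrix units sends f to 4 (N + 1) h, where
   h = f - (d_S + d_{S^c}) / (N + 1), and its carre du champ at f is at least -8.
   Integrating by parts against h^(2p+1),
     (N + 1) E[h^(2p+2)] <= 2 (2p + 1) E[h^(2p)],
   hence E[h^(2p)] <= p! (4 / (N + 1))^p.  Markov's inequality for every p, summed
   with the weights of the exponential series, yields
     P(h > delta) <= 2 exp(- (N + 1) delta^2 / 8),
   which is stronger than required; a union bound over S concludes. *)
Require Import Defs.
From mathcomp Require Import all_boot all_order all_algebra.
From mathcomp Require Import all_classical all_reals all_analysis.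
From mathcomp Require Import measurable_realfun complex ring lra.
Set Implicit Arguments.
Unset Strict Implicit.
Unset Printing Implicit Defensive.
Import Order.TTheory GRing.Theory Num.Theory.
Import numFieldNormedType.Exports.
Local Open Scope classical_set_scope.
Local Open Scope ring_scope.
Local Open Scope sesquilinear_scope.

(** Each [D_A] is a formal operator, tied to analysis only by a second-order expansion along one
    explicit unitary flow. Invariance of the mean then kills the first-order term, with no
    differentiation under the integral. Off-diagonal matrix units generate no unitary flow, but the
    derivation is complex linear in [A] and they are combinations of rank-one projectors, which do.
    Complex linearity makes amplitudes and their conjugates behave as independent variables, so the
    Casimir sums become polynomial identities over a commutative ring. The constant -8 arises as
    follows: [D f] is twice an entry of the commutator of [rho] with [rho_S (x) 1], so the carre du
    champ is [8 (f^2 - Tr rho_S^3)], and [Tr rho_S^3 <= 1]. It is not positive because this Casimir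
    sum is minus a Laplacian. *)

(** * Continuity of the linear action and of real and imaginary parts *)

Lemma mulmx_continuous (K : numFieldType) m p q (U : 'M[K]_(m, p)) :
  continuous (fun x : 'M[K]_(p, q) => U *m x).
Proof.
move=> x A [P /= nP PA].
have : \forall y \near nbhs x, forall i j, P i j ((U *m y) i j).
  apply: (filter_forall (nbhs_filter x)) => i.
  apply: (filter_forall (nbhs_filter x)) => j.
  have cf : continuous (fun y : 'M[K]_(p, q) => (U *m y) i j).
    rewrite (_ : (fun _ => _) = (fun y : 'M[K]_(p, q) => \sum_k U i k * y k j)); last first.
      by apply/funext => y; rewrite mxE.
    apply: continuous_big => [|k _ y].
      by move=> [a b]; apply: (@cvgD K K^o); [exact: cvg_fst|exact: cvg_snd].
    apply: cvgMl_tmp; first exact: (nbhs_filter y).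
    exact: coord_continuous.
  exact: (cf x _ (nP i j)).
by apply: filterS => y h; exact: PA.
Qed.

(** * Bounded measurable functions on the sphere and their means *)

Section Complex.
Variable R : realType.
Notation C := (Cplx R).
Definition re (z : C) : R := complex.Re z.
Definition im (z : C) : R := complex.Im z.

Lemma reD (x y : C) : re (x + y) = re x + re y. Proof. by case: x; case: y. Qed.

Lemma imD (x y : C) : im (x + y) = im x + im y. Proof. by case: x; case: y. Qed.

Lemma reB (x y : C) : re (x - y) = re x - re y. Proof. by case: x; case: y. Qed.

Lemma reM (x y : C) : re (x * y) = re x * re y - im x * im y.
Proof. by case: x; case: y. Qed.

Lemma imM (x y : C) : im (x * y) = re x * im y + im x * re y.
Proof. by case: x; case: y. Qed.

Lemma re_le (z : C) (K : R) : `|z| <= (K%:C)%C -> `|re z| <= K.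
Proof.
move=> h; rewrite -lecR; apply: le_trans h.
rewrite normc_def lecR -sqrtr_sqr ler_sqrt ?lerDl ?sqr_ge0//.
by rewrite addr_ge0 ?sqr_ge0.
Qed.

Lemma re_continuous : continuous re.
Proof.
move=> z A /nbhs_ballP[e /= e0 He].
apply/nbhs_ballP; exists (e%:C)%C; first by rewrite /= ltcR.
move=> y; rewrite /ball_ /= => yz; apply: He.
rewrite /ball /= -reB.
move: yz; rewrite normc_def ltcR; apply: le_lt_trans.
rewrite -sqrtr_sqr ler_sqrt ?lerDl ?sqr_ge0//.
by rewrite addr_ge0 ?sqr_ge0.
Qed.

Lemma im_continuous : continuous im.
Proof.
move=> z A /nbhs_ballP[e /= e0 He].
apply/nbhs_ballP; exists (e%:C)%C; first by rewrite /= ltcR.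
move=> y; rewrite /ball_ /= => yz; apply: He.
rewrite /ball /=.
have -> : im z - im y = im (z - y) by case: (z); case: (y).
move: yz; rewrite normc_def ltcR; apply: le_lt_trans.
rewrite -sqrtr_sqr ler_sqrt ?lerDr ?sqr_ge0//.
by rewrite addr_ge0 ?sqr_ge0.
Qed.

Lemma im_conj (x : C) : im (x^*) = - im x.
Proof. by case: x. Qed.

Lemma re_conj (x : C) : re (x^*) = re x.
Proof. by case: x. Qed.

Lemma C_eq (x y : C) : re x = re y -> im x = im y -> x = y.
Proof. by case: x; case: y => a b c d /= -> ->. Qed.
End Complex.

Section Meas.
Variables (R : realType) (d n : nat).
Notation C := (Cplx R).
Notation T := (borel_ket R d n).
Notation N := #|comp_basis d n|.
Notation S := (@unit_sphere R d n).

Lemma measurable_continuous (f : ket R d n -> R) : continuous f ->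
  measurable_fun setT (f : T -> R).
Proof.
move=> /continuousP cf; apply: (measurability _ (RGenOpens.measurableE R)).
move=> _ [_ [a [b ->] <-]]; rewrite setTI.
by apply: sub_sigma_algebra; apply: cf; exact: interval_open.
Qed.

Definition cmeas (F : ket R d n -> C) :=
  measurable_fun setT (fun x : T => re (F x)) /\
  measurable_fun setT (fun x : T => im (F x)).

Lemma cmeas_coord i : cmeas (fun x => x i 0).
Proof.
split; apply: measurable_continuous => x; apply: continuous_comp;
  try exact: coord_continuous; [exact: re_continuous|exact: im_continuous].
Qed.

Lemma cmeas_cst c : cmeas (fun=> c).
Proof. by split; exact: measurable_cst. Qed.

Lemma cmeasD F G : cmeas F -> cmeas G -> cmeas (fun x => F x + G x).
Proof.
move=> [a b] [a' b']; split.
  by rewrite (_ : (fun _ => _) = (fun x : T => re (F x) + re (G x)));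
    [exact: measurable_funD|apply/funext => x; rewrite reD].
by rewrite (_ : (fun _ => _) = (fun x : T => im (F x) + im (G x)));
    [exact: measurable_funD|apply/funext => x; rewrite imD].
Qed.

Lemma cmeasM F G : cmeas F -> cmeas G -> cmeas (fun x => F x * G x).
Proof.
move=> [a b] [a' b']; split.
  rewrite (_ : (fun _ => _) = (fun x : T => re (F x) * re (G x) - im (F x) * im (G x)));
    last by apply/funext => x; rewrite reM.
  by apply: measurable_funB; apply: measurable_funM.
rewrite (_ : (fun _ => _) = (fun x : T => re (F x) * im (G x) + im (F x) * re (G x)));
    last by apply/funext => x; rewrite imM.
by apply: measurable_funD; apply: measurable_funM.
Qed.

Lemma cmeas_conj F : cmeas F -> cmeas (fun x => (F x)^*).
Proof.
move=> [a b]; split.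
  rewrite (_ : (fun _ => _) = (fun x : T => re (F x)))//.
  by apply/funext => x; rewrite re_conj.
rewrite (_ : (fun _ => _) = (fun x : T => - im (F x))); last first.
  by apply/funext => x; rewrite im_conj.
exact: measurable_funN.
Qed.

Lemma sphereE (x : ket R d n) : S x <-> \sum_i `|x i 0| ^+ 2 = 1.
Proof.
rewrite /unit_sphere /=; split.
  move=> /matrixP/(_ 0 0); rewrite !mxE eqxx => h; apply: etrans h.
  by apply: eq_bigr => i _; rewrite !mxE normCKC.
move=> h; apply/matrixP => i j; rewrite !ord1 !mxE eqxx; apply: etrans h.
by apply: eq_bigr => k _; rewrite !mxE normCKC.
Qed.

Lemma cmeas_sum (I : Type) (r : seq I) (P : pred I) (F : I -> ket R d n -> C) :
  (forall i, cmeas (F i)) -> cmeas (fun x => \sum_(i <- r | P i) F i x).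
Proof.
move=> h; elim: r => [|i r IH].
  rewrite (_ : (fun _ => _) = (fun=> 0)); first exact: cmeas_cst.
  by apply/funext => x; rewrite big_nil.
case Pi : (P i).
  rewrite (_ : (fun _ => _) = (fun x => F i x + \sum_(i <- r | P i) F i x)).
    exact: cmeasD.
  by apply/funext => x; rewrite big_cons Pi.
rewrite (_ : (fun _ => _) = (fun x => \sum_(i <- r | P i) F i x))//.
by apply/funext => x; rewrite big_cons Pi.
Qed.

(** The squared norm is automatically real, so the sphere is the preimage of 1 under a measurable
    real function. *)
Lemma measurable_sphere : measurable (S : set T).
Proof.
have m : cmeas (fun x => \sum_i x i 0 * (x i 0)^*).
  by apply: cmeas_sum => i; apply: cmeasM; [|apply: cmeas_conj]; exact: cmeas_coord.
have := (m.1 measurableT [set 1] (measurable_set1 1)).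
rewrite setTI; congr (measurable _); apply/seteqP; split => x.
  rewrite /= => h; apply/sphereE.
  under eq_bigr do rewrite normCK.
  apply: C_eq; first exact: h.
  transitivity (0 : R); last by [].
  apply: ger0_Im; apply: sumr_ge0 => i _.
  exact: mul_conjC_ge0.
move=> /sphereE h; rewrite /=.
by under eq_bigr do rewrite -normCK; rewrite h.
Qed.

Lemma measurable_mulmx (U : 'M[C]_N) :
  measurable_fun setT ((fun x : ket R d n => U *m x) : T -> T).
Proof.
apply: (@measurability _ _ T T setT _ (@open (ket R d n)) erefl).
move=> _ [A oA <-]; rewrite setTI; apply: sub_sigma_algebra.
by move: A oA; apply/continuousP; exact: mulmx_continuous.
Qed.

Lemma unitary_sphere (U : 'M[C]_N) x : U \is unitarymx -> S (U *m x) <-> S x.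
Proof.
move=> uU; rewrite /unit_sphere /= trmx_mul map_mxM -mulmxA (mulmxA _ U).
have -> : U^t* *m U = 1%:M.
  by rewrite -invmx_unitary// mulVmx// unitarymx_unit.
by rewrite mul1mx.
Qed.

Variable mu : probability T R.

(** Measurability is global, but boundedness is asked on the sphere only: polynomials in the
    amplitudes are unbounded on the ambient space. *)
Definition bdmeas (F : ket R d n -> C) :=
  cmeas F /\ exists K : R, forall x, S x -> `|F x| <= (K%:C)%C.

(** Keeping the real part loses nothing, since a complex coefficient can be absorbed into [F]. *)
Definition Emean (F : ket R d n -> C) : R := \int[mu]_(x in S) re (F x).

Lemma bdmeas_integrable F : bdmeas F -> mu.-integrable S (EFin \o (fun x => re (F x))).
Proof.
move=> [[mF _] [K hK]].
apply: measurable_bounded_integrable => //.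
- exact: measurable_sphere.
- by apply: le_lt_trans (probability_le1 mu measurable_sphere) _; rewrite ltry.
- exact: measurable_funTS.
- exists K; split; first exact: num_real.
  by move=> x Kx y Sy; apply: le_trans (ltW Kx); exact/re_le/hK.
Qed.

Lemma EmeanD F G : bdmeas F -> bdmeas G -> Emean (fun x => F x + G x) = Emean F + Emean G.
Proof.
move=> bF bG; rewrite /Emean; under eq_Rintegral do rewrite reD.
by apply: RintegralD; [exact: measurable_sphere|exact: bdmeas_integrable..].
Qed.

Lemma bdmeasD F G : bdmeas F -> bdmeas G -> bdmeas (fun x => F x + G x).
Proof.
move=> [mF [K hK]] [mG [L hL]]; split; first exact: cmeasD.
exists (K + L) => x Sx; apply: le_trans (ler_normD _ _) _.
by rewrite rmorphD /= lerD ?hK ?hL.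
Qed.

Lemma bdmeasM F G : bdmeas F -> bdmeas G -> bdmeas (fun x => F x * G x).
Proof.
move=> [mF [K hK]] [mG [L hL]]; split; first exact: cmeasM.
exists (K * L) => x Sx; rewrite normrM.
by rewrite rmorphM /= ler_pM ?hK ?hL.
Qed.

Lemma bdmeas_cst c : bdmeas (fun=> c).
Proof.
split; first exact: cmeas_cst.
by exists (Num.sqrt (re c ^+ 2 + im c ^+ 2)) => x _; rewrite normc_def.
Qed.

Lemma bdmeas_coord i : bdmeas (fun x => x i 0).
Proof.
split; first exact: cmeas_coord.
exists 1 => x /sphereE h; rewrite -[leRHS](_ : 1 = _)//.
rewrite -(@ler_pXn2r _ 2)// ?nnegrE// expr1n -h (bigD1 i)//= lerDl.
by apply: sumr_ge0 => j _; rewrite exprn_ge0.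
Qed.

Lemma bdmeas_conj F : bdmeas F -> bdmeas (fun x => (F x)^*).
Proof.
move=> [mF [K hK]]; split; first exact: cmeas_conj.
by exists K => x Sx; rewrite norm_conjC hK.
Qed.

Lemma bdmeasZ c F : bdmeas F -> bdmeas (fun x => c * F x).
Proof. by move=> bF; apply: bdmeasM => //; exact: bdmeas_cst. Qed.

Lemma bdmeas_sum (I : Type) (r : seq I) (P : pred I) (F : I -> ket R d n -> C) :
  (forall i, bdmeas (F i)) -> bdmeas (fun x => \sum_(i <- r | P i) F i x).
Proof.
move=> h; elim: r => [|i r IH].
  rewrite (_ : (fun _ => _) = (fun=> 0)); first exact: bdmeas_cst.
  by apply/funext => x; rewrite big_nil.
case Pi : (P i).
  rewrite (_ : (fun _ => _) = (fun x => F i x + \sum_(i <- r | P i) F i x)).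
    exact: bdmeasD.
  by apply/funext => x; rewrite big_cons Pi.
rewrite (_ : (fun _ => _) = (fun x => \sum_(i <- r | P i) F i x))//.
by apply/funext => x; rewrite big_cons Pi.
Qed.

Lemma Emean_le F (K : R) : mu S = 1%E -> bdmeas F ->
  (forall x, S x -> `|F x| <= (K%:C)%C) -> `|Emean F| <= K.
Proof.
move=> S1 bF hK.
apply: le_trans (le_normr_Rintegral measurable_sphere (bdmeas_integrable bF)) _.
rewrite -[leRHS]mulr1 -[X in _ * X](_ : fine (mu S) = 1); last by rewrite S1.
rewrite -(Rintegral_cst mu measurable_sphere).
apply: le_Rintegral.
- exact: measurable_sphere.
- by have := integrable_norm (bdmeas_integrable bF).
- have := bdmeas_integrable (bdmeas_cst (K%:C)%C); exact.
- by move=> x Sx; exact/re_le/hK.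
Qed.

(** Change of variables: the pushforward of [mu] by [U] agrees with [mu] on Borel sets, and [U]
    preserves the sphere. *)
Lemma Emean_unitary F (U : 'M[C]_N) : haar_state mu -> U \is unitarymx -> bdmeas F ->
  bdmeas (fun x => F (U *m x)) -> Emean (fun x => F (U *m x)) = Emean F.
Proof.
move=> [S1 inv] uU bF bFU; rewrite /Emean /Rintegral; congr fine.
have pS : (fun x : T => (U *m x) : T) @^-1` S = S.
  by apply/seteqP; split => x /=; rewrite unitary_sphere.
have := @integral_pushforward _ _ T T R _ (measurable_mulmx U) mu S
  (EFin \o (fun x => re (F x))).
rewrite pS => /(_ _ _ measurable_sphere) <-; last 2 first.
- by apply/measurable_EFinP; exact: bF.1.1.
- exact: bdmeas_integrable.
apply: eq_measure_integral => [|mphi A mA _]; [exact: measurable_mulmx|exact: inv].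
Qed.
End Meas.

(** * Derivations from unitary invariance *)

Section Pair.
Variables (K : numClosedFieldType) (n : nat).
Implicit Types (a b : 'I_n) (c : K).
(** For [a != b] and [|c| = 1], the orthogonal projector onto the line spanned by
    [e_a + c^* e_b]. *)
Definition pair_proj a b c : 'M[K]_n :=
  2^-1 *: (delta_mx a a + delta_mx b b + c *: delta_mx a b + c^* *: delta_mx b a).
Lemma pair_projP a b c : a != b -> c * c^* = 1 ->
  (pair_proj a b c)^t* = pair_proj a b c /\
  pair_proj a b c *m pair_proj a b c = pair_proj a b c.
Proof.
move=> ab cc; have ba : b != a by rewrite eq_sym.
split; rewrite /pair_proj.
  have cV : (2^-1 : K)^* = 2^-1 by rewrite rmorphV ?unitfE ?pnatr_eq0//= conjC_nat.
  rewrite linearZ /= !linearD /= !linearZ /= !trmx_delta !map_mxD !map_mxZ !map_delta_mx /=.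
  by rewrite conjCK cV; apply/matrixP => i j; rewrite !mxE; ring.
rewrite -scalemxAl -scalemxAr !mulmxDl !mulmxDr -!scalemxAl -!scalemxAr.
rewrite !mul_delta_mx !mul_delta_mx_0//.
rewrite !scaler0 !addr0 !add0r !scalerA (mulrC c^*) cc !scale1r.
by apply/matrixP => i j; rewrite !mxE; field.
Qed.

Lemma pair_one : 1 * 1^* = 1 :> K. Proof. by rewrite rmorph1 mulr1. Qed.

Lemma pair_i : - 'i * (- 'i)^* = 1 :> K.
Proof. by rewrite rmorphN /= conjCi opprK mulNr -expr2 sqrCi opprK. Qed.

(** Polarisation: in [P_1 + i P_(-i)] the [(b, a)] entries cancel and the diagonal excess is
    [(1 + i) / 2]. The leading [1 *:] and the final [+ 0] give every layer the shape [a *: A + B] of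
    [null_dir_lin]. *)
Lemma delta_pair_proj a b : delta_mx a b = 1 *: pair_proj a b 1 + ('i *: pair_proj a b (- 'i) +
  (- (2^-1 * (1 + 'i)) *: delta_mx a a + (- (2^-1 * (1 + 'i)) *: delta_mx b b + 0))).
Proof.
apply/matrixP => i j; rewrite !mxE rmorph1 rmorphN /= conjCi.
have ii : 'i * 'i = -1 :> K by rewrite -expr2 sqrCi.
set x := (_ && _)%:R; set y := (_ && _)%:R; set z := (_ && _)%:R; set w := (_ && _)%:R.
transitivity ((2^-1 - 2^-1 * ('i * 'i)) * x + (2^-1 + 2^-1 * ('i * 'i)) * w); last by ring.
by rewrite ii; field.
Qed.
End Pair.

(** * A rational parametrisation of the unit circle *)

Section Flow.
Variables (R : realType).
Notation C := (Cplx R).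

Definition toC (t : R) : C := (t%:C)%C.
(* [locked] keeps [normrM] and [mulrAC] from seeing a product through [rate]. *)
Definition rate (t : R) : C := locked (2 * 'i * toC t).
Lemma rateE t : rate t = 2 * 'i * toC t. Proof. by rewrite /rate -lock. Qed.

(* [1 + rotc t = (1 + i t) / (1 - i t)] parametrises the unit circle rationally,
   and [rate t = 2 i t] is its first-order term. *)
Definition rotc (t : R) : C := rate t / (1 - 'i * toC t).

Lemma toCM x y : toC (x * y) = toC x * toC y. Proof. exact: rmorphM. Qed.

Lemma toCX x m : toC (x ^+ m) = toC x ^+ m. Proof. exact: rmorphXn. Qed.

Lemma toC_conj t : (toC t)^* = toC t.
Proof. by apply: C_eq; rewrite ?re_conj ?im_conj//= oppr0. Qed.

Lemma rate_conj t : (rate t)^* = - rate t.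
Proof. by rewrite rateE !rmorphM /= conjCi toC_conj conjC_nat; ring. Qed.

Lemma norm_toC t : 0 <= t -> `|toC t| = toC t.
Proof. by move=> t0; rewrite ger0_norm// /toC ler0c. Qed.

Lemma norm_rate t : 0 <= t -> `|rate t| = toC (2 * t).
Proof.
move=> t0; rewrite rateE !normrM normCi norm_toC// mulr1 normr_nat.
by rewrite /toC rmorphM /= rmorph_nat.
Qed.

Lemma den_norm t : (1 - 'i * toC t) * (1 - 'i * toC t)^* = 1 + toC t ^+ 2.
Proof.
rewrite rmorphB rmorphM /= conjCi toC_conj rmorph1.
have := sqrCi C; rewrite expr2 => e.
transitivity (1 - ('i * 'i) * toC t ^+ 2); first by ring.
by rewrite e; ring.
Qed.

Lemma den_ge1 t : 1 <= `|1 - 'i * toC t|.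
Proof.
rewrite -(@ler_pXn2r _ 2)// ?nnegrE// expr1n normCK den_norm lerDl.
have -> : toC t ^+ 2 = toC (t ^+ 2) by rewrite /toC rmorphXn.
by rewrite /toC ler0c sqr_ge0.
Qed.

Lemma den_neq0 t : 1 - 'i * toC t != 0.
Proof. by rewrite -normr_gt0 (lt_le_trans ltr01 (den_ge1 t)). Qed.

(** This is [|1 + rotc t|^2 = 1] with the constant cancelled, the form needed for the unitarity of
    [rot]. *)
Lemma rotc_unit t : rotc t + (rotc t)^* + rotc t * (rotc t)^* = 0.
Proof.
have h := den_neq0 t; have h' : (1 - 'i * toC t)^* != 0 by rewrite conjC_eq0.
rewrite /rotc rmorphM /= rmorphV ?unitfE//= rate_conj.
have -> : (1 - 'i * toC t)^* = 1 + 'i * toC t.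
  by rewrite rmorphB rmorphM /= conjCi toC_conj rmorph1 mulNr opprK.
move: h'.
rewrite rmorphB rmorphM /= conjCi toC_conj rmorph1 mulNr opprK => h'.
rewrite rateE; field.
by rewrite h h'.
Qed.

Lemma rotc_rate t : 0 <= t -> `|rotc t - rate t| <= toC (2 * t ^+ 2).
Proof.
move=> t0; have h := den_neq0 t.
have -> : rotc t - rate t = rate t * ('i * toC t) / (1 - 'i * toC t).
  by rewrite /rotc; field; rewrite h.
rewrite normrM (normrM (rate t)) (normrM 'i) norm_rate// normCi mul1r norm_toC// normfV.
have -> : toC (2 * t ^+ 2) = toC (2 * t) * toC t.
  by rewrite /toC -rmorphM /= expr2 mulrA.
apply: ler_piMr; first by rewrite mulr_ge0// /toC ler0c// mulr_ge0.
by rewrite invf_le1 ?den_ge1// (lt_le_trans ltr01 (den_ge1 t)).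
Qed.
End Flow.

(** * Derivations, and their vanishing mean *)

Section Der.
Variables (R : realType) (d n : nat).
Notation C := (Cplx R).
Notation T := (borel_ket R d n).
Notation N := #|comp_basis d n|.
Notation S := (@unit_sphere R d n).
Notation ket := (ket R d n).

Definition projector (P : 'M[C]_N) := P^t* = P /\ P *m P = P.
(** For a projector [P], the phase [1 + rotc t] on its range and the identity on the orthogonal
    complement, so no matrix exponential is involved. *)
Definition rot (P : 'M[C]_N) t : 'M[C]_N := 1%:M + rotc t *: P.

Lemma rot_unitary P t : projector P -> rot P t \is unitarymx.
Proof.
move=> [h i]; apply/unitarymxP; rewrite /rot.
rewrite linearD /= map_mxD linearZ /= map_mxZ h trmx1 map_mx1.
rewrite mulmxDl mul1mx mulmxDr mulmx1 -scalemxAl -scalemxAr i scalerA.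
rewrite -addrA -!scalerDl addrCA addrA /=.
by rewrite rotc_unit scale0r addr0.
Qed.

(* [DF A] is the derivative of [F] along the linear vector field [x |-> A x]. It is
   tested only on projectors, whose flow [rot P] is unitary; the vector field of
   [rot P t] at [t = 0] is [2 i P]. *)
Definition der (F : ket -> C) (DF : 'M[C]_N -> ket -> C) :=
  [/\ bdmeas F, forall A, bdmeas (DF A),
    forall a A B x, DF (a *: A + B) x = a * DF A x + DF B x &
    forall P, projector P -> exists K : R, forall x, S x -> forall t : R, 0 <= t <= 1 ->
      `|F (rot P t *m x) - F x - rate t * DF P x| <= toC (K * t ^+ 2)].

Lemma der_ext F DF G DG : der F DF -> F =1 G -> (forall A, DF A =1 DG A) -> der G DG.
Proof.
move=> h /funext <- e; suff -> : DG = DF by [].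
by apply/funext => A; apply/esym/funext.
Qed.

Lemma der_cst c : der (fun=> c) (fun _ _ => 0).
Proof.
split=> [|A|a A B x|P _]; try exact: bdmeas_cst; first by rewrite mulr0 addr0.
by exists 0 => x _ t _; rewrite subrr sub0r mulr0 oppr0 normr0 mul0r.
Qed.

Lemma derD F DF G DG : der F DF -> der G DG ->
  der (fun x => F x + G x) (fun A x => DF A x + DG A x).
Proof.
move=> [bF bDF lF eF] [bG bDG lG eG]; split.
- exact: bdmeasD.
- by move=> A; exact: bdmeasD.
- by move=> a A B x; rewrite lF lG; ring.
- move=> P pP; have [K hK] := eF P pP; have [L hL] := eG P pP.
  exists (K + L) => x Sx t t01.
  rewrite (_ : _ - _ = (F (rot P t *m x) - F x - rate t * DF P x) +
    (G (rot P t *m x) - G x - rate t * DG P x)); last by ring.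
  apply: le_trans (ler_normD _ _) _.
  by rewrite mulrDl /toC rmorphD /= lerD ?hK ?hL.
Qed.

Lemma derM F DF G DG : der F DF -> der G DG ->
  der (fun x => F x * G x) (fun A x => DF A x * G x + F x * DG A x).
Proof.
move=> [bF bDF lF eF] [bG bDG lG eG]; split.
- exact: bdmeasM.
- by move=> A; apply: bdmeasD; exact: bdmeasM.
- by move=> a A B x; rewrite lF lG; ring.
- move=> P pP; have [K hK] := eF P pP; have [L hL] := eG P pP.
  have [_ [f hf]] := bF; have [_ [g hg]] := bG.
  have [_ [f' hf']] := bDF P; have [_ [g' hg']] := bDG P.
  (* One summand for each term of the splitting below; [t <= 1] bounds [|rate t| = 2 t] by 2 in the
     second, and [|rate t|^2 = 4 t^2] gives the third. *)
  exists (K * g + (f + 2 * f') * L + 4 * f' * g') => x Sx t /andP[t0 t1].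
  set y := rot P t *m x; have Sy : S y by apply/unitary_sphere => //; exact: rot_unitary.
  rewrite (_ : _ - _ = (F y - F x - rate t * DF P x) * G y
     + (F x + rate t * DF P x) * (G y - G x - rate t * DG P x)
     + rate t ^+ 2 * DF P x * DG P x); last by ring.
  rewrite (mulrDl (_ + _) _ (t ^+ 2)) (mulrDl (K * g)) /toC !rmorphD /=.
  apply: le_trans (ler_normD _ _) _; apply: lerD.
    apply: le_trans (ler_normD _ _) _; apply: lerD.
      rewrite normrM mulrAC rmorphM /= ler_pM ?hg//.
      by apply: hK => //; rewrite t0.
    rewrite normrM -mulrA rmorphM /= ler_pM//; last by apply: hL => //; rewrite t0.
    apply: le_trans (ler_normD _ _) _; rewrite rmorphD /= lerD ?hf//.
    rewrite normrM norm_rate// rmorphM /= ler_pM// ?hf'//.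
      by rewrite /toC ler0c mulr_ge0.
    by rewrite /toC lecR; lra.
  rewrite normrM (normrM (_ ^+ 2)) normrX norm_rate//.
  rewrite (_ : 4 * f' * g' * t ^+ 2 = ((2 * t) ^+ 2) * f' * g'); last by ring.
  rewrite -[leRHS]/(toC _) (toCM (_ * f')) (toCM (_ ^+ 2)) toCX ler_pM ?hg'//.
    by rewrite mulr_ge0// exprn_ge0// /toC ler0c mulr_ge0.
  by rewrite ler_pM ?hf'// exprn_ge0// /toC ler0c mulr_ge0.
Qed.

Lemma derZ c F DF : der F DF -> der (fun x => c * F x) (fun A x => c * DF A x).
Proof.
move=> h; apply: der_ext (derM (der_cst c) h) _ _ => // A x.
by rewrite mul0r add0r.
Qed.

Lemma der_sum (I : Type) (r : seq I) F DF : (forall i, der (F i) (DF i)) ->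
  der (fun x => \sum_(i <- r) F i x) (fun A x => \sum_(i <- r) DF i A x).
Proof.
move=> h; elim: r => [|i r IH].
  by apply: der_ext (der_cst 0) _ _ => [x|A x]; rewrite big_nil.
by apply: der_ext (derD (h i) IH) _ _ => [x|A x]; rewrite big_cons.
Qed.

Lemma derX F DF m : der F DF ->
  der (fun x => F x ^+ m.+1) (fun A x => m.+1%:R * F x ^+ m * DF A x).
Proof.
move=> h; elim: m => [|m IH].
  by apply: der_ext h _ _ => [x|A x]; rewrite ?expr1// expr0 !mul1r.
apply: der_ext (derM h IH) _ _ => [x|A x]; rewrite -?exprS//.
by rewrite -[m.+2]add1n natrD exprS; ring.
Qed.

Lemma der_coord i : der (fun x => x i 0) (fun A x => (A *m x) i 0).
Proof.
have b A : bdmeas (fun x : ket => (A *m x) i 0).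
  rewrite (_ : (fun _ => _) = fun x : ket => \sum_k A i k * x k 0).
    by apply: bdmeas_sum => k; apply: bdmeasZ; exact: bdmeas_coord.
  by apply/funext => x; rewrite mxE.
split=> //; first exact: bdmeas_coord.
  by move=> a A B x; rewrite mulmxDl -scalemxAl !mxE.
move=> P pP; have [_ [K hK]] := b P; exists (2 * K) => x Sx t /andP[t0 t1].
rewrite mulmxDl mul1mx -scalemxAl (mxE _ _ i) (mxE _ _ i).
rewrite (_ : _ - _ = (rotc t - rate t) * (P *m x) i 0); last by ring.
by rewrite normrM mulrAC /toC rmorphM /= ler_pM ?hK ?rotc_rate.
Qed.

(** The rate is imaginary, so conjugating the expansion of the coordinate flips the sign of its
    first-order term. Leaving [A] unconjugated keeps the derivative complex linear in [A]; on a
    Hermitian [P] both readings agree. *)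
Lemma der_conj_coord i : der (fun x => (x i 0)^*) (fun A x => - (x^t* *m A) 0 i).
Proof.
have b A : bdmeas (fun x : ket => - (x^t* *m A) 0 i).
  rewrite (_ : (fun _ => _) = fun x : ket => \sum_k (- A k i) * (x k 0)^*).
    by apply: bdmeas_sum => k; apply: bdmeasZ; apply: bdmeas_conj; exact: bdmeas_coord.
  apply/funext => x; rewrite mxE -sumrN; apply: eq_bigr => k _.
  by rewrite !mxE mulNr mulrC.
split=> //; first exact/bdmeas_conj/bdmeas_coord.
  by move=> a A B x; rewrite mulmxDr -scalemxAr !mxE; ring.
move=> P pP; have [_ _ _ e] := der_coord i; have [K hK] := e P pP.
exists K => x Sx t t01; apply: le_trans (hK x Sx t t01).
rewrite -[leRHS]norm_conjC !rmorphB rmorphM /= rate_conj.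
have -> : (x^t* *m P) 0 i = ((P *m x) i 0)^*.
  by rewrite -[P in LHS]pP.1 -map_mxM -trmx_mul !mxE.
by rewrite mulrN mulNr.
Qed.

Variable mu : probability T R.
Hypothesis haar : haar_state mu.

Lemma bdmeas_mulmx F (U : 'M[C]_N) : U \is unitarymx -> bdmeas F ->
  bdmeas (fun x : ket => F (U *m x)).
Proof.
move=> uU [[a b] [K hK]]; split.
  split.
    by have := measurableT_comp a (measurable_mulmx U).
  by have := measurableT_comp b (measurable_mulmx U).
by exists K => x Sx; apply: hK; apply/unitary_sphere.
Qed.

(** The mean of [F] composed with [rot P t] does not depend on [t], so the first-order term is
    [O(t^2)] in mean; divide by [t] and let it tend to 0. *)
Lemma Emean_der_proj F DF P : der F DF -> projector P -> Emean mu (DF P) = 0.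
Proof.
move=> hF pP.
have c0 : 2 * 'i != 0 :> C by rewrite mulf_neq0 ?neq0Ci ?pnatr_eq0.
(* Rescaling [F] by [1 / (2 i)] turns the imaginary rate into the real factor [t], which commutes
   with the real part in [Emean]. *)
have [bG bDG _ /(_ P pP)[K hK]] := derZ (2 * 'i)^-1 hF.
have bDF : bdmeas (DF P) by case: hF.
have key t : 0 <= t <= 1 -> t * `|Emean mu (DF P)| <= K * t ^+ 2.
  move=> t01; have /andP[t0 _] := t01.
  set G := (fun x => _ * F x) in bG.
  have uU := rot_unitary t pP.
  have bGU := bdmeas_mulmx uU bG.
  have bt : bdmeas (fun x => - (toC t * DF P x)).
    by rewrite (_ : (fun _ => _) = fun x => (- toC t) * DF P x);
     [exact: bdmeasZ|apply/funext => x; rewrite mulNr].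
  have bG' : bdmeas (fun x => - G x).
    by rewrite (_ : (fun _ => _) = fun x => -1 * G x);
     [exact: bdmeasZ|apply/funext => x; rewrite mulN1r].
  have := @Emean_le _ _ _ mu
    (fun x => G (rot P t *m x) + - G x + - (toC t * DF P x)) (K * t ^+ 2) haar.1.
  have e : Emean mu (fun x => - (toC t * DF P x)) = - t * Emean mu (DF P).
    rewrite /Emean -RintegralZl; last 2 first.
    - exact: measurable_sphere.
    - exact: bdmeas_integrable.
    apply: eq_Rintegral => x _; rewrite -mulNr reM.
    by rewrite (_ : re (- toC t) = - t)// (_ : im (- toC t) = 0) ?mul0r ?subr0//= oppr0.
  have e' : Emean mu (fun x => - G x) = - Emean mu G.
    rewrite -mulN1r /Emean -RintegralZl; last 2 first.
    - exact: measurable_sphere.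
    - exact: bdmeas_integrable.
    by apply: eq_Rintegral => x _; rewrite mulN1r; case: (G x).
  rewrite !EmeanD//; last exact: bdmeasD.
  rewrite e e' Emean_unitary// subrr add0r normrM normrN (ger0_norm t0).
  apply; first by apply: bdmeasD => //; exact: bdmeasD.
  move=> x Sx; apply: le_trans (hK x Sx t t01).
  rewrite le_eqVlt; apply/orP; left; apply/eqP; congr (`|_ - _|).
  by rewrite rateE mulrACA mulfV// mul1r.
apply/eqP; rewrite -normr_eq0; apply/eqP/le_anti; rewrite normr_ge0 andbT.
apply/ler_addgt0Pr => e e0; rewrite add0r.
have K0 : 0 <= K.
  by have := key 1; rewrite ler01 lexx mul1r expr1n mulr1 => /(_ isT); apply: le_trans.
(* [K + 1] rather than [K], which may vanish. *)
pose t := Num.min 1 (e / (K + 1)).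
have t0 : 0 < t by rewrite lt_min ltr01 divr_gt0// ltr_wpDl.
have t1 : t <= 1 by rewrite ge_min lexx.
have te : t <= e / (K + 1) by rewrite ge_min lexx orbT.
have := key t; rewrite (ltW t0) t1 => /(_ isT).
rewrite expr2 mulrA mulrC ler_pM2r// => h; apply: le_trans h _.
apply: le_trans (_ : (K + 1) * t <= _).
  by rewrite ler_wpM2r ?lerDl// ltW.
by rewrite mulrC -ler_pdivlMr// ltr_wpDl.
Qed.

Definition null_dir (A : 'M[C]_N) := forall F DF, der F DF -> Emean mu (DF A) = 0.

(** The complex scalar moves into the function, [a * F] having derivation [a * DF]; for this
    [null_dir] quantifies over all [F]. *)
Lemma null_dir_lin a A B : null_dir A -> null_dir B -> null_dir (a *: A + B).
Proof.
move=> hA hB F DF hF; have [_ bD l _] := hF.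
rewrite (_ : DF (a *: A + B) = fun x => a * DF A x + DF B x); last first.
  by apply/funext => x; rewrite l.
rewrite EmeanD//; last exact: bdmeasZ.
by rewrite (hB _ _ hF) (hA _ _ (derZ a hF)) addr0.
Qed.

Lemma null_dir_delta a b : null_dir (delta_mx a b).
Proof.
have diag c : null_dir (delta_mx c c).
  move=> F DF hF; apply: Emean_der_proj hF _; split; last exact: mul_delta_mx.
  by rewrite trmx_delta map_delta_mx.
have [<-//|ab] := eqVneq a b.
have ba : b != a by rewrite eq_sym.
have half (c : C) (cc : c * c^* = 1) : null_dir (pair_proj a b c).
  by move=> F DF hF; apply: Emean_der_proj hF _; exact: pair_projP.
have h0 : null_dir 0.
  by have := null_dir_lin (-1) (diag a) (diag a); rewrite scaleN1r addNr.
rewrite (delta_pair_proj C a b).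
apply: null_dir_lin; first exact: half (pair_one C).
apply: null_dir_lin; first exact: half (pair_i C).
by do 2 (apply: null_dir_lin; first exact: diag).
Qed.
End Der.

Lemma sum_delta (K : comNzRingType) (I : finType) (i : I) (F : I -> K) :
  \sum_j (j == i)%:R * F j = F i.
Proof.
rewrite (bigD1 i)//= eqxx mul1r big1 ?addr0// => j /negPf ->.
by rewrite mul0r.
Qed.

(** * The purity and its derivatives *)

Section Purity.
Variables (K : comNzRingType) (A E : finType).
Implicit Types (X Y dX dY : A -> E -> K) (a b p q : A) (c e : E).

(* [X] stands for the amplitudes and [Y] for their conjugates, decoupled so that
   the identities below are polynomial; [marginal X Y] is then the reduced state,
   [lmul] and [rmul] are [(rho_S (x) 1) psi] and [psi^* (rho_S (x) 1)], and a
   prefix [d] marks the derivative given those [dX], [dY] of [X] and [Y]. *)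
Definition marginal X Y a b := \sum_c X a c * Y b c.
Definition purity X Y := \sum_a \sum_b marginal X Y a b * marginal X Y b a.
Definition lmul X Y a c := \sum_b marginal X Y a b * X b c.
Definition rmul X Y a c := \sum_b Y b c * marginal X Y b a.

Definition dmarginal X Y dX dY a b := \sum_c (dX a c * Y b c + X a c * dY b c).
Definition dpurity X Y dX dY := \sum_a \sum_b
  (dmarginal X Y dX dY a b * marginal X Y b a + marginal X Y a b * dmarginal X Y dX dY b a).
Definition dlmul X Y dX dY a c :=
  \sum_b (dmarginal X Y dX dY a b * X b c + marginal X Y a b * dX b c).
Definition drmul X Y dX dY a c :=
  \sum_b (dY b c * marginal X Y b a + Y b c * dmarginal X Y dX dY b a).

(* The derivatives of [X] and [Y] along the matrix unit in row [(p, e)] and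
   column [(q, e')]. *)
Definition delta_dx X p e q e' : A -> E -> K :=
  fun a c => (a == p)%:R * ((c == e)%:R * X q e').
Definition delta_dy Y p e q e' : A -> E -> K :=
  fun a c => - ((a == q)%:R * ((c == e')%:R * Y p e)).

Variables (X Y : A -> E -> K).
Notation s := (marginal X Y).
Notation u := (lmul X Y).
Notation v := (rmul X Y).
Notation f := (purity X Y).

Lemma dmarginal_delta p e q e' a b :
  dmarginal X Y (delta_dx X p e q e') (delta_dy Y p e q e') a b =
  (a == p)%:R * (X q e' * Y b e) - (b == q)%:R * (X a e' * Y p e).
Proof.
rewrite /dmarginal big_split /= /delta_dx /delta_dy; congr (_ + _).
  rewrite -[X q e' * _](sum_delta e (fun c => X q e' * Y b c)) mulr_sumr.
  by apply: eq_bigr => c _; ring.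
rewrite -[X a e' * _](sum_delta e' (fun c => X a c * Y p e)) mulr_sumr -sumrN.
by apply: eq_bigr => c _; ring.
Qed.

(** Entry in row [(q, e')] and column [(p, e)] of the commutator of [rho] with [rho_S (x) 1]. *)
Definition grad p e q e' := X q e' * v p e - Y p e * u q e'.

Lemma dpurity_delta p e q e' :
  dpurity X Y (delta_dx X p e q e') (delta_dy Y p e q e') = 2 * grad p e q e'.
Proof.
rewrite /dpurity; set ds := dmarginal _ _ _ _.
have h : \sum_a \sum_b ds a b * s b a = grad p e q e'.
  under eq_bigr => a _ do under eq_bigr => b _ do rewrite /ds dmarginal_delta.
  transitivity (\sum_a (a == p)%:R * (\sum_b X q e' * (Y b e * s b a))
     - \sum_b (b == q)%:R * \sum_a Y p e * (s b a * X a e')).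
    rewrite [X in _ - X](eq_bigr
      (fun b => \sum_a (b == q)%:R * (Y p e * (s b a * X a e')))); last first.
      by move=> b _; rewrite mulr_sumr.
    rewrite [X in _ - X]exchange_big /= -sumrB; apply: eq_bigr => a _.
    rewrite mulr_sumr -sumrB; apply: eq_bigr => b _; ring.
  by rewrite !sum_delta -!mulr_sumr.
under eq_bigr do rewrite big_split; rewrite big_split /= h.
rewrite exchange_big /=.
rewrite (_ : \sum_j _ = grad p e q e'); first by ring.
by rewrite -h; apply: eq_bigr => a _; apply: eq_bigr => b _; rewrite mulrC.
Qed.

(** Only the entry at the column index of the matrix unit occurs, since the Casimir sum pairs each
    unit with its transpose. *)
Lemma drmul_delta p e q e' :
  drmul X Y (delta_dx X p e q e') (delta_dy Y p e q e') q e' =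
  - (Y p e * s q q) + Y p e' * X q e' * Y q e - Y p e * \sum_b Y b e' * X b e'.
Proof.
rewrite /drmul big_split /= -addrA; congr (_ + _).
  rewrite -[RHS](sum_delta q (fun b => - (Y p e * s b q))).
  by apply: eq_bigr => b _; rewrite /delta_dy eqxx /=; ring.
under eq_bigr => b _ do rewrite dmarginal_delta eqxx /= mulrBr.
rewrite sumrB; congr (_ - _).
  rewrite -[RHS](sum_delta p (fun b => Y b e' * X q e' * Y q e)).
  by apply: eq_bigr => b _; ring.
by rewrite mulr_sumr; apply: eq_bigr => b _; ring.
Qed.

Lemma dlmul_delta p e q e' :
  dlmul X Y (delta_dx X p e q e') (delta_dy Y p e q e') p e =
  X q e' * (\sum_b Y b e * X b e) - X p e' * Y p e * X q e + s p p * X q e'.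
Proof.
rewrite /dlmul big_split /=; congr (_ + _); last first.
  rewrite -[RHS](sum_delta p (fun b => s p b * X q e')).
  by apply: eq_bigr => b _; rewrite /delta_dx eqxx /=; ring.
under eq_bigr => b _ do rewrite dmarginal_delta eqxx /= mulrBl.
rewrite sumrB; congr (_ - _).
  by rewrite mulr_sumr; apply: eq_bigr => b _; ring.
rewrite -[RHS](sum_delta q (fun b => X p e' * Y p e * X b e)).
by apply: eq_bigr => b _; ring.
Qed.

Definition dgrad dX dY p e q e' :=
  (dX q e' * v p e + X q e' * drmul X Y dX dY p e) -
  (dY p e * u q e' + Y p e * dlmul X Y dX dY q e').

Hypothesis tr1 : \sum_a \sum_c X a c * Y a c = 1.

Lemma sum_Xv : \sum_a \sum_c X a c * v a c = f.
Proof.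
rewrite /purity; apply: eq_bigr => a _.
under eq_bigr do rewrite mulr_sumr.
rewrite exchange_big; apply: eq_bigr => b _ /=.
by rewrite mulr_suml; apply: eq_bigr => c _; ring.
Qed.

Lemma sum_Yu : \sum_a \sum_c Y a c * u a c = f.
Proof.
rewrite /purity; apply: eq_bigr => a _.
under eq_bigr do rewrite mulr_sumr.
rewrite exchange_big; apply: eq_bigr => b _ /=.
by rewrite mulr_sumr; apply: eq_bigr => c _; ring.
Qed.

Lemma sum4_mul (F G : A -> E -> K) :
  \sum_p \sum_e \sum_q \sum_e' F p e * G q e' =
  (\sum_p \sum_e F p e) * (\sum_q \sum_e' G q e').
Proof.
rewrite mulr_suml; apply: eq_bigr => p _; rewrite mulr_suml; apply: eq_bigr => e _.
by rewrite mulr_sumr; apply: eq_bigr => q _; rewrite mulr_sumr.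
Qed.

Lemma sum4D (F G : A -> E -> A -> E -> K) :
  \sum_p \sum_e \sum_q \sum_e' (F p e q e' + G p e q e') =
  \sum_p \sum_e \sum_q \sum_e' F p e q e' + \sum_p \sum_e \sum_q \sum_e' G p e q e'.
Proof.
rewrite -big_split; apply: eq_bigr => p _; rewrite -big_split; apply: eq_bigr => e _.
by rewrite -big_split; apply: eq_bigr => q _; rewrite -big_split.
Qed.

Lemma sum4Z k (F : A -> E -> A -> E -> K) :
  \sum_p \sum_e \sum_q \sum_e' (k * F p e q e') =
  k * \sum_p \sum_e \sum_q \sum_e' F p e q e'.
Proof.
rewrite mulr_sumr; apply: eq_bigr => p _; rewrite mulr_sumr; apply: eq_bigr => e _.
by rewrite mulr_sumr; apply: eq_bigr => q _; rewrite mulr_sumr.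
Qed.

Lemma eq_sum4 (F G : A -> E -> A -> E -> K) : (forall p e q e', F p e q e' = G p e q e') ->
  \sum_p \sum_e \sum_q \sum_e' F p e q e' = \sum_p \sum_e \sum_q \sum_e' G p e q e'.
Proof.
by move=> h; do 4 (apply: eq_bigr => ? _); exact: h.
Qed.

(** This is [Tr rho_S^3]. *)
Definition grad_sq := \sum_p \sum_e u p e * v p e.

(** The trace of the squared commutator: with [M = rho_S (x) 1] and [rho] a rank-one projector, [Tr
    [rho, M]^2 = 2 (Tr rho M)^2 - 2 Tr (rho M^2)]. *)
Lemma sum_grad2 :
  \sum_p \sum_e \sum_q \sum_e' grad p e q e' * grad q e' p e = 2 * f ^+ 2 - 2 * grad_sq.
Proof.
transitivity (\sum_p \sum_e \sum_q \sum_e'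
  ((X p e * v p e) * (X q e' * v q e') + ((-1 * ((X p e * Y p e) * (u q e' * v q e'))
   + -1 * ((u p e * v p e) * (X q e' * Y q e'))) + (Y p e * u p e) * (Y q e' * u q e')))).
  by apply: eq_sum4 => p e q e'; rewrite /grad; ring.
rewrite !sum4D !sum4Z !sum4_mul sum_Xv sum_Yu tr1 -/grad_sq; ring.
Qed.

(** Terms with a free index pair give [#|A| * #|E|] copies of [f], twice; the two index exchanges
    give one [f] each, hence the [+ 1]. Terms reducing to traces of the two marginals give [- #|E|]
    and [- #|A|], each twice. *)
Lemma sum_dgrad :
  \sum_p \sum_e \sum_q \sum_e'
    dgrad (delta_dx X q e' p e) (delta_dy Y q e' p e) p e q e' =
  2 * ((#|A| * #|E| + 1)%:R * f - #|A|%:R - #|E|%:R).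
Proof.
transitivity (\sum_p \sum_e \sum_q \sum_e' ((X p e * v p e) * 1 + (1 * (Y q e' * u q e')
  + ((-1 * ((s p p) * (X q e' * Y q e')) + -1 * ((X p e * Y p e) * s q q))
  + (-1 * ((\sum_b Y b e * X b e) * (X q e' * Y q e')) +
    -1 * ((X p e * Y p e) * (\sum_b Y b e' * X b e'))))
 + (X p e * Y q e * (X q e' * Y p e') + X q e * Y p e * (X p e' * Y q e'))))).
  apply: eq_sum4 => p e q e'.
  rewrite /dgrad drmul_delta dlmul_delta /delta_dx /delta_dy !eqxx /=; ring.
rewrite !sum4D !sum4Z !sum4_mul sum_Xv sum_Yu tr1.
have c1 : \sum_(p : A) \sum_(e : E) (1 : K) = (#|A| * #|E|)%:R.
  by under eq_bigr do rewrite sumr_const; rewrite sumr_const -mulrnA mulnC.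
have c2 : \sum_p \sum_(e : E) s p p = #|E|%:R.
  under eq_bigr do rewrite sumr_const -mulr_natl.
  by rewrite -mulr_sumr /marginal tr1 mulr1.
have c3 : \sum_(p : A) \sum_(e : E) \sum_b Y b e * X b e = #|A|%:R.
  rewrite sumr_const exchange_big /=.
  rewrite (eq_bigr (fun a => \sum_c X a c * Y a c)) ?tr1// => a _.
  by apply: eq_bigr => c _; rewrite mulrC.
have c4 : \sum_p \sum_e \sum_q \sum_e' X p e * Y q e * (X q e' * Y p e') = f.
  apply: eq_bigr => p _; rewrite exchange_big; apply: eq_bigr => q _ /=.
  rewrite /marginal mulr_suml; apply: eq_bigr => e _.
  by rewrite mulr_sumr.
have c5 : \sum_p \sum_e \sum_q \sum_e' X q e * Y p e * (X p e' * Y q e') = f.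
  apply: eq_bigr => p _; rewrite exchange_big; apply: eq_bigr => q _ /=.
  rewrite mulrC /marginal mulr_suml; apply: eq_bigr => e _.
  by rewrite mulr_sumr.
have c6 : \sum_(p : A) \sum_(e : E) f = (#|A| * #|E|)%:R * f.
  rewrite -c1 mulr_suml; apply: eq_bigr => p _; rewrite mulr_suml.
  by apply: eq_bigr => e _; rewrite mul1r.
rewrite c1 c2 c3 c4 c5 c6 natrD; ring.
Qed.
End Purity.

(** * Bounds on the purity and its gradient *)

Section Bounds.
Variables (K : numClosedFieldType) (A E : finType).

Lemma CauchySchwarz_sum (I : finType) (x y : I -> K) :
  `|\sum_i x i * y i| ^+ 2 <= (\sum_i `|x i| ^+ 2) * (\sum_i `|y i| ^+ 2).
Proof.
apply: le_trans (_ : (\sum_i `|x i| * `|y i|) ^+ 2 <= _).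
  have xy0 : 0 <= \sum_i `|x i| * `|y i| by apply: sumr_ge0 => i _; rewrite mulr_ge0.
  rewrite ler_pXn2r ?nnegrE//.
  by apply: le_trans (ler_norm_sum _ _ _) _; apply: ler_sum => i _; rewrite normrM.
(* Lagrange's identity. *)
have e : (\sum_i `|x i| ^+ 2) * (\sum_i `|y i| ^+ 2) - (\sum_i `|x i| * `|y i|) ^+ 2 =
  2^-1 * \sum_i \sum_j (`|x i| * `|y j| - `|x j| * `|y i|) ^+ 2.
  have -> : \sum_i \sum_j (`|x i| * `|y j| - `|x j| * `|y i|) ^+ 2 =
     \sum_i \sum_j ((`|x i| ^+ 2 * `|y j| ^+ 2 + `|y i| ^+ 2 * `|x j| ^+ 2) -
       2 * ((`|x i| * `|y i|) * (`|x j| * `|y j|))).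
    by apply: eq_bigr => i _; apply: eq_bigr => j _; ring.
  have m (F G : I -> K) : (\sum_i F i) * (\sum_j G j) = \sum_i \sum_j F i * G j.
    by rewrite mulr_suml; apply: eq_bigr => i _; rewrite mulr_sumr.
  under [in RHS]eq_bigr do rewrite sumrB big_split /=.
  rewrite sumrB big_split /= -!m.
  rewrite (_ : \sum_i \sum_j 2 * _ = 2 * (\sum_i `|x i| * `|y i|) ^+ 2); first by field.
  rewrite expr2 m mulr_sumr; apply: eq_bigr => i _; by rewrite mulr_sumr.
rewrite -subr_ge0 e mulr_ge0 ?invr_ge0 ?ler0n// sumr_ge0// => i _; rewrite sumr_ge0// => j _.
by rewrite real_exprn_even_ge0// rpredB// rpredM ?normr_real.
Qed.

Variable X : A -> E -> K.
Hypothesis nX : \sum_a \sum_c `|X a c| ^+ 2 = 1.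
Let Y a c := (X a c)^*.
Notation s := (marginal X Y).
Notation u := (lmul X Y).
Notation v := (rmul X Y).

Lemma marginal_conj a b : (s a b)^* = s b a.
Proof.
rewrite /marginal rmorph_sum; apply: eq_bigr => c _.
by rewrite rmorphM /= /Y conjCK mulrC.
Qed.

Lemma rmul_conj a c : v a c = (u a c)^*.
Proof.
rewrite /rmul /lmul rmorph_sum; apply: eq_bigr => b _.
by rewrite rmorphM /= marginal_conj mulrC.
Qed.

Lemma purityE : purity X Y = \sum_a \sum_b `|s a b| ^+ 2.
Proof.
by apply: eq_bigr => a _; apply: eq_bigr => b _; rewrite -(marginal_conj a b) normCK.
Qed.

Lemma grad_sqE : grad_sq X Y = \sum_a \sum_c `|u a c| ^+ 2.
Proof.
by apply: eq_bigr => a _; apply: eq_bigr => b _; rewrite rmul_conj normCK.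
Qed.

Lemma purity_ge0 : 0 <= purity X Y.
Proof.
by rewrite purityE sumr_ge0// => a _; rewrite sumr_ge0// => b _; rewrite exprn_ge0.
Qed.

Lemma purity_le1 : purity X Y <= 1.
Proof.
rewrite purityE.
apply: le_trans (_ : \sum_a \sum_b (\sum_c `|X a c| ^+ 2) * (\sum_c `|X b c| ^+ 2) <= _).
  apply: ler_sum => a _; apply: ler_sum => b _.
  apply: le_trans (CauchySchwarz_sum _ _) _.
  by under [X in _ * X <= _]eq_bigr do rewrite norm_conjC.
under eq_bigr do rewrite -mulr_sumr nX mulr1.
by rewrite nX.
Qed.

(** Cauchy-Schwarz on each entry of [u] bounds this by the purity. *)
Lemma grad_sq_le1 : grad_sq X Y <= 1.
Proof.
rewrite grad_sqE.
apply: le_trans (_ : \sum_a \sum_c (\sum_b `|s a b| ^+ 2) * (\sum_b `|X b c| ^+ 2) <= _).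
  by apply: ler_sum => a _; apply: ler_sum => c _; exact: CauchySchwarz_sum.
have nX' : \sum_c \sum_b `|X b c| ^+ 2 = 1 by rewrite exchange_big.
under eq_bigr do rewrite -mulr_sumr nX' mulr1.
by rewrite -purityE purity_le1.
Qed.
End Bounds.

(** * Moments and tails of the centred purity *)

Section Glue.
Variables (d n : nat) (S0 : {set 'I_n}).

Lemma glue_in (a : sub_basis d S0) (c : env_basis d S0) i (h : i \in S0) :
  glue_basis a c i = a (exist _ i h).
Proof.
rewrite ffunE.
(* Generalising the last index of [alt_spec] makes the case analysis well typed; irrelevance of
   Boolean proofs then identifies the membership witnesses. *)
have gen b (q : alt_spec (i \in S0) (i \in S0) b) :
    match q with AltTrue iS => a (exist _ i iS) | AltFalse iNS => c (exist _ i iNS) end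
    = a (exist _ i h).
  by case: q => [i1|i1]; [rewrite (bool_irrelevance i1 h)|have := i1; rewrite h].
exact: gen.
Qed.

Lemma glue_notin (a : sub_basis d S0) (c : env_basis d S0) i (h : i \notin S0) :
  glue_basis a c i = c (exist _ i h).
Proof.
rewrite ffunE.
have gen b (q : alt_spec (i \in S0) (i \in S0) b) :
    match q with AltTrue iS => a (exist _ i iS) | AltFalse iNS => c (exist _ i iNS) end
    = c (exist _ i h).
  by case: q => [i1|i1]; [have := h; rewrite i1|rewrite (bool_irrelevance i1 h)].
exact: gen.
Qed.

Lemma glue_inj (a a' : sub_basis d S0) (c c' : env_basis d S0) :
  glue_basis a c = glue_basis a' c' -> a = a' /\ c = c'.
Proof.
move=> /ffunP h; split; apply/ffunP => -[i iS].
  by have := h i; rewrite !glue_in.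
by have := h i; rewrite !glue_notin.
Qed.

Definition tau (a : 'I_#|sub_basis d S0|) (c : env_basis d S0) : 'I_#|comp_basis d n| :=
  enum_rank (glue_basis (enum_val a) c).

Lemma tau_eq a c a' c' : (tau a c == tau a' c') = (a == a') && (c == c').
Proof.
apply/eqP/andP => [/enum_rank_inj/glue_inj[/enum_val_inj -> ->]|[/eqP -> /eqP ->]] //.
Qed.

Lemma card_sub_basis : #|sub_basis d S0| = (d ^ #|S0|)%N.
Proof. by rewrite card_ffun card_ord card_sig. Qed.

Lemma card_env_basis : #|env_basis d S0| = (d ^ (n - #|S0|))%N.
Proof.
rewrite card_ffun card_ord card_sig; congr (_ ^ _)%N.
have := cardC (mem S0); rewrite card_ord => e.
by rewrite -[X in (X - _)%N]e addKn; apply: eq_card.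
Qed.

Lemma card_split : (#|sub_basis d S0| * #|env_basis d S0| = #|comp_basis d n|)%N.
Proof.
rewrite card_sub_basis card_env_basis card_comp_basis -expnD subnKC//.
by have := max_card (mem S0); rewrite card_ord.
Qed.

Lemma sum_tau (V : nmodType) (F : 'I_#|comp_basis d n| -> V) :
  \sum_i F i = \sum_a \sum_c F (tau a c).
Proof.
rewrite pair_big /=.
rewrite (reindex (fun p : 'I_#|sub_basis d S0| * env_basis d S0 => tau p.1 p.2)) //=.
apply/onW_bij/inj_card_bij.
  by move=> [a c] [a' c'] /= /eqP; rewrite tau_eq => /andP[/eqP -> /eqP ->].
by rewrite card_ord card_prod card_ord card_split.
Qed.
End Glue.

Section DeltaAction.
Variables (K : numClosedFieldType) (N : nat).
Lemma delta_mul_col (i j k : 'I_N) (x : 'cV[K]_N) :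
  (delta_mx i j *m x) k 0 = (k == i)%:R * x j 0.
Proof.
rewrite mxE (bigD1 j)//= big1 ?addr0 => [|l /negPf lj].
  by rewrite mxE eqxx andbT.
by rewrite mxE lj andbF mul0r.
Qed.

Lemma row_mul_delta (i j k : 'I_N) (x : 'rV[K]_N) :
  (x *m delta_mx i j) 0 k = (k == j)%:R * x 0 i.
Proof.
rewrite mxE (bigD1 i)//= big1 ?addr0 => [|l /negPf lj].
  by rewrite mxE eqxx mulrC.
by rewrite mxE lj mulr0.
Qed.
End DeltaAction.

Section EllMore.
Variables (R : realType) (d n : nat) (mu : probability (borel_ket R d n) R).
Notation C := (Cplx R).
Notation S := (@unit_sphere R d n).
Implicit Types F G : ket R d n -> C.

Lemma EmeanZ (r : R) F : bdmeas F -> Emean mu (fun x => toC r * F x) = r * Emean mu F.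
Proof.
move=> bF; rewrite /Emean -RintegralZl; last 2 first.
- exact: measurable_sphere.
- exact: bdmeas_integrable.
apply: eq_Rintegral => x _.
by rewrite reM (_ : re (toC r) = r)// (_ : im (toC r) = 0)// mul0r subr0.
Qed.

Lemma Emean_mono F G : bdmeas F -> bdmeas G ->
  (forall x, S x -> F x <= G x) -> Emean mu F <= Emean mu G.
Proof.
move=> bF bG FG; apply: le_Rintegral.
- exact: measurable_sphere.
- exact: bdmeas_integrable.
- exact: bdmeas_integrable.
- by move=> x /FG; rewrite lecE => /andP[].
Qed.

(** Both properties travel together so that the lemma can be nested over four indices. *)
Lemma Emean0_sum (I : finType) (F : I -> ket R d n -> C) :
  (forall i, bdmeas (F i) /\ Emean mu (F i) = 0) ->
  bdmeas (fun x => \sum_i F i x) /\ Emean mu (fun x => \sum_i F i x) = 0.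
Proof.
move=> h; elim: (index_enum I) => [|i r [b e]].
  rewrite (_ : (fun _ => _) = fun=> 0); last by apply/funext => x; rewrite big_nil.
  split; first exact: bdmeas_cst.
  rewrite /Emean Rintegral_cst ?mul0r//; exact: measurable_sphere.
rewrite (_ : (fun _ => _) = fun x => F i x + \sum_(j <- r) F j x); last first.
  by apply/funext => x; rewrite big_cons.
have [bi ei] := h i.
by split; [exact: bdmeasD|rewrite EmeanD// ei e addr0].
Qed.
End EllMore.

(** * Integration by parts for the centred purity *)

Section Moment.
Variables (R : realType) (d n : nat) (mu : probability (borel_ket R d n) R).
Variable S0 : {set 'I_n}.
Notation C := (Cplx R).
Notation S := (@unit_sphere R d n).
Notation N := #|comp_basis d n|.
Notation ket := (ket R d n).
Notation A := 'I_#|sub_basis d S0|.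
Notation E := (env_basis d S0).
Notation tau := (@tau d n S0).
Hypothesis haar : haar_state mu.

Definition amp (x : ket) (a : A) (c : E) : C := x (tau a c) 0.
Definition ampJ (x : ket) (a : A) (c : E) : C := (x (tau a c) 0)^*.
Definition damp (M : 'M[C]_N) (x : ket) (a : A) (c : E) : C := (M *m x) (tau a c) 0.
Definition dampJ (M : 'M[C]_N) (x : ket) (a : A) (c : E) : C := - (x^t* *m M) 0 (tau a c).

Lemma purity_tr x :
  \tr (reduced S0 (density x) *m reduced S0 (density x)) = purity (amp x) (ampJ x).
Proof.
apply: eq_bigr => a _; rewrite mxE; apply: eq_bigr => b _.
by congr (_ * _); rewrite mxE; apply: eq_bigr => c _; rewrite mxE big_ord1 !mxE.
Qed.

Lemma der_marginal a b : der (fun x => marginal (amp x) (ampJ x) a b)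
  (fun M x => dmarginal (amp x) (ampJ x) (damp M x) (dampJ M x) a b).
Proof. by apply: der_sum => c; apply: derM; [exact: der_coord|exact: der_conj_coord]. Qed.

Lemma der_purity : der (fun x => purity (amp x) (ampJ x))
  (fun M x => dpurity (amp x) (ampJ x) (damp M x) (dampJ M x)).
Proof. by apply: der_sum => a; apply: der_sum => b; apply: derM; exact: der_marginal. Qed.

Lemma der_lmul a c : der (fun x => lmul (amp x) (ampJ x) a c)
  (fun M x => dlmul (amp x) (ampJ x) (damp M x) (dampJ M x) a c).
Proof. by apply: der_sum => b; apply: derM; [exact: der_marginal|exact: der_coord]. Qed.

Lemma der_rmul a c : der (fun x => rmul (amp x) (ampJ x) a c)
  (fun M x => drmul (amp x) (ampJ x) (damp M x) (dampJ M x) a c).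
Proof. by apply: der_sum => b; apply: derM; [exact: der_conj_coord|exact: der_marginal]. Qed.

Lemma derB F DF G DG : der F DF -> der G DG ->
  der (fun x : ket => F x - G x) (fun M x => DF M x - DG M x).
Proof.
move=> hF hG; apply: der_ext (derD hF (derZ (-1) hG)) _ _ => [x|M x]; by rewrite mulN1r.
Qed.

Lemma der_grad p e q e' : der (fun x => grad (amp x) (ampJ x) p e q e')
  (fun M x => dgrad (amp x) (ampJ x) (damp M x) (dampJ M x) p e q e').
Proof.
apply: derB; apply: derM.
- exact: der_coord.
- exact: der_rmul.
- exact: der_conj_coord.
- exact: der_lmul.
Qed.

Lemma damp_delta p e q e' x :
  damp (delta_mx (tau p e) (tau q e')) x = delta_dx (amp x) p e q e'.
Proof.
apply/funext => a; apply/funext => c.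
by rewrite /damp delta_mul_col /delta_dx tau_eq -mulnb natrM mulrA.
Qed.

Lemma dampJ_delta p e q e' x :
  dampJ (delta_mx (tau p e) (tau q e')) x = delta_dy (ampJ x) p e q e'.
Proof.
apply/funext => a; apply/funext => c.
by rewrite /dampJ row_mul_delta /delta_dy tau_eq -mulnb natrM mulrA !mxE.
Qed.

(* [d ^ n + 1]. *)
Definition dim1 := (#|{: A}| * #|{: E}| + 1)%N.
Definition mean_purity : C := (#|{: A}|%:R + #|{: E}|%:R) / dim1%:R.
Definition cpurity (x : ket) : C := purity (amp x) (ampJ x) - mean_purity.

Lemma der_cpurity : der cpurity (fun M x => dpurity (amp x) (ampJ x) (damp M x) (dampJ M x)).
Proof.
by apply: der_ext (derB der_purity (der_cst d n mean_purity)) _ _ => // M x; rewrite subr0.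
Qed.

Lemma dim1_neq0 : dim1%:R != 0 :> C.
Proof. by rewrite pnatr_eq0 /dim1 addn1. Qed.

Lemma amp_trace x : S x -> \sum_a \sum_c amp x a c * ampJ x a c = 1.
Proof.
move=> /sphereE <-; rewrite (sum_tau S0); apply: eq_bigr => a _; apply: eq_bigr => c _.
by rewrite normCK.
Qed.

(* Mean of the sum over [p, q] of [D_qp (D_pq f * h ^+ m.+1)], up to a factor 2. *)
Lemma Emean_gradE m : exists G, [/\ bdmeas G, Emean mu G = 0 & forall x, S x ->
  G x = 2 * dim1%:R * cpurity x ^+ m.+2 +
    4 * m.+1%:R * (cpurity x ^+ m * (purity (amp x) (ampJ x) ^+ 2 - grad_sq (amp x) (ampJ x)))].
Proof.
pose G p e q e' (x : ket) : C :=
  dgrad (amp x) (ampJ x) (delta_dx (amp x) q e' p e) (delta_dy (ampJ x) q e' p e) p e q e' *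
    cpurity x ^+ m.+1 +
  grad (amp x) (ampJ x) p e q e' *
    (m.+1%:R * cpurity x ^+ m * (2 * grad (amp x) (ampJ x) q e' p e)).
have hG p e q e' : bdmeas (G p e q e') /\ Emean mu (G p e q e') = 0.
  (* [grad] is half of [D f] along the unit [(p, e), (q, e')]; its product with the power of [h] is
     differentiated along the transposed unit. *)
  have dk := derM (der_grad p e q e') (derX m der_cpurity).
  have eG : G p e q e' = (fun x => dgrad (amp x) (ampJ x) (damp (delta_mx (tau q e') (tau p e)) x)
      (dampJ (delta_mx (tau q e') (tau p e)) x) p e q e' * cpurity x ^+ m.+1 +
    grad (amp x) (ampJ x) p e q e' * (m.+1%:R * cpurity x ^+ m * dpurity (amp x) (ampJ x)
      (damp (delta_mx (tau q e') (tau p e)) x) (dampJ (delta_mx (tau q e') (tau p e)) x))).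
    by apply/funext => x; rewrite /G damp_delta dampJ_delta dpurity_delta.
  rewrite eG; split; first by have [_ b _ _] := dk; exact: b.
  exact: (null_dir_delta haar (tau q e') (tau p e) dk).
exists (fun x => \sum_p \sum_e \sum_q \sum_e' G p e q e' x).
have [b z] := Emean0_sum (fun p => Emean0_sum (fun e => Emean0_sum (fun q =>
  Emean0_sum (fun e' => hG p e q e')))).
split => // x /amp_trace tr1.
rewrite /G sum4D.
under [X in X + _]eq_bigr do under eq_bigr do under eq_bigr do rewrite -mulr_suml.
under [X in X + _]eq_bigr do under eq_bigr do rewrite -mulr_suml.
under [X in X + _]eq_bigr do rewrite -mulr_suml.
rewrite -mulr_suml sum_dgrad//.
rewrite (eq_sum4 (G := fun p e q e' => (2 * m.+1%:R * cpurity x ^+ m) *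
  (grad (amp x) (ampJ x) p e q e' * grad (amp x) (ampJ x) q e' p e))); last first.
  by move=> p e q e'; ring.
rewrite sum4Z sum_grad2// -/dim1.
(* The Casimir sum is affine in the purity, and [mean_purity] is its zero. *)
have -> : dim1%:R * purity (amp x) (ampJ x) - #|{: A}|%:R - #|{: E}|%:R = dim1%:R * cpurity x.
  by rewrite /cpurity /mean_purity; field; rewrite dim1_neq0.
rewrite !exprS; ring.
Qed.
End Moment.

(** * Moment recursion and exponential tail *)

Section Tail.
Variables (R : realType) (d n : nat) (mu : probability (borel_ket R d n) R).
Variable S0 : {set 'I_n}.
Notation C := (Cplx R).
Notation T := (borel_ket R d n).
Notation S := (@unit_sphere R d n).
Notation ket := (ket R d n).
Hypothesis haar : haar_state mu.
Notation h := (cpurity S0).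
Notation dim1 := (dim1 d S0).
Notation f := (fun x : ket => purity (@amp R d n S0 x) (@ampJ R d n S0 x)).
Notation w := (fun x : ket => grad_sq (@amp R d n S0 x) (@ampJ R d n S0 x)).

Lemma toC_nat (m : nat) : toC (m%:R : R) = m%:R.
Proof. by rewrite /toC rmorph_nat. Qed.

Lemma amp_normed x : S x -> \sum_a \sum_c `|@amp R d n S0 x a c| ^+ 2 = 1.
Proof.
move=> /(amp_trace S0) <-; apply: eq_bigr => a _; apply: eq_bigr => c _.
by rewrite normCK.
Qed.

Lemma purity_itv x : S x -> 0 <= f x <= 1.
Proof. by move=> /amp_normed Sx; rewrite purity_ge0 purity_le1. Qed.

Lemma mean_purityE : mean_purity R d S0 =
  toC ((#|{: 'I_#|sub_basis d S0|}|%:R + #|{: env_basis d S0}|%:R) / dim1%:R).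
Proof. have e (a b c : nat) : toC ((a%:R + b%:R) / c%:R : R) = (a%:R + b%:R) / c%:R.
  by rewrite toCM -!toC_nat; congr (_ * _); [exact: rmorphD|exact: fmorphV].
by rewrite e. Qed.

Lemma cpurity_real x : S x -> h x = toC (re (h x)).
Proof.
move=> /purity_itv/andP[/ger0_real f0 _].
have : h x \is Num.real by rewrite rpredB// mean_purityE; apply/complex_realP; eexists.
by move=> /RRe_real <-.
Qed.

Lemma bdmeas_cpurityX m : bdmeas (fun x : ket => h x ^+ m).
Proof.
elim: m => [|m IH].
  exact: bdmeas_cst.
rewrite (_ : (fun _ => _) = fun x : ket => h x * h x ^+ m); last first.
  by apply/funext => x; rewrite exprS.
by apply: bdmeasM => //; have [] := der_cpurity R d S0.
Qed.

Definition moment p := Emean mu (fun x : ket => h x ^+ (2 * p)).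

Lemma moment0 : moment 0 = 1.
Proof.
transitivity (\int[mu]_(x in S) (1 : R)); first by apply: eq_Rintegral => x _; rewrite muln0.
rewrite Rintegral_cst; last exact: measurable_sphere.
exact: etrans (congr1 (fun z => 1 * fine z) haar.1) (mulr1 1).
Qed.

(** The weight [h ^+ (2 * p)] is nonnegative on the sphere, so [f^2 - Tr rho_S^3 >= -1] may be
    inserted under the mean. *)
Lemma momentS p : dim1%:R * moment p.+1 <= 2 * (2 * p).+1%:R * moment p.
Proof.
have [G [bG G0 eG]] := Emean_gradE S0 haar (2 * p).
have b1 : bdmeas (fun x : ket => toC (2 * dim1%:R) * h x ^+ (2 * p.+1)).
  by apply: bdmeasZ; exact: bdmeas_cpurityX.
have b2 : bdmeas (fun x : ket => toC (- (4 * (2 * p).+1%:R)) * h x ^+ (2 * p)).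
  by apply: bdmeasZ; exact: bdmeas_cpurityX.
have : Emean mu (fun x : ket => toC (2 * dim1%:R) * h x ^+ (2 * p.+1) +
    toC (- (4 * (2 * p).+1%:R)) * h x ^+ (2 * p)) <= Emean mu G.
  apply: Emean_mono => //; first exact: bdmeasD.
  move=> x Sx; rewrite eG//.
  have -> : toC (2 * dim1%:R : R) = 2 * dim1%:R by rewrite toCM -!toC_nat.
  have -> : toC (- (4 * (2 * p).+1%:R) : R) = - (4 * (2 * p).+1%:R).
    by rewrite /toC rmorphN; congr (- _); rewrite -[LHS]/(toC _) toCM -!toC_nat.
  have -> : (2 * p.+1 = (2 * p).+2)%N by rewrite mulnS.
  rewrite lerD2l -subr_ge0.
  have hp : 0 <= h x ^+ (2 * p).
    by rewrite cpurity_real// -toCX /toC ler0c exprM exprn_ge0 ?sqr_ge0.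
  rewrite (_ : _ - _ =
    4 * (2 * p).+1%:R * h x ^+ (2 * p) * (f x ^+ 2 + (1 - w x))); last by ring.
  have /andP[f0 _] := purity_itv Sx.
  apply: mulr_ge0; first by rewrite mulr_ge0// mulr_ge0.
  by rewrite addr_ge0 ?exprn_ge0// subr_ge0 grad_sq_le1//; exact: amp_normed.
rewrite G0 EmeanD// !EmeanZ; try exact: bdmeas_cpurityX.
rewrite -/(moment p) -/(moment p.+1) => k; lra.
Qed.

(** Rounding [2 (2 p + 1)] up to [4 (p + 1)] makes the recursion solve to a factorial. *)
Lemma moment_le p : moment p <= p`!%:R * (4 / dim1%:R) ^+ p.
Proof.
have D0 : 0 < dim1%:R :> R by rewrite ltr0n /dim1 addn1.
elim: p => [|p IH]; first by rewrite moment0 fact0 expr0 mulr1.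
rewrite -(ler_pM2l D0); apply: le_trans (momentS p) _.
have c0 : 0 <= 2 * (2 * p).+1%:R :> R by rewrite mulr_ge0.
apply: le_trans (ler_wpM2l c0 IH) _.
rewrite factS natrM exprS.
have -> : dim1%:R * (p.+1%:R * p`!%:R * (4 / dim1%:R * (4 / dim1%:R) ^+ p)) =
    4 * p.+1%:R * (p`!%:R * (4 / dim1%:R) ^+ p) :> R.
  by field; rewrite lt0r_neq0.
apply: ler_wpM2r; first by rewrite mulr_ge0// exprn_ge0// divr_ge0// ltW.
have : (2 * p).+1%:R = 2 * p%:R + 1 :> R by rewrite -addn1 natrD natrM.
have : p.+1%:R = p%:R + 1 :> R by rewrite -addn1 natrD.
move=> -> ->; lra.
Qed.

(** Strict, so that the complement in the sphere is the closed condition of [approx_kuniform]. *)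
Definition tail_set (delta : R) : set T := S `&` [set x | delta < re (h x)].

Lemma measurable_tail delta : measurable (tail_set delta).
Proof.
apply: measurableI; first exact: measurable_sphere.
have [[m _] _] : bdmeas (h : ket -> C) by have [] := der_cpurity R d S0.
have := m measurableT `]delta, +oo[%classic (measurable_itv _).
by rewrite setTI; congr measurable; apply/seteqP; split => x /=; rewrite in_itv /= andbT.
Qed.

Lemma tail_moment delta p : 0 <= delta ->
  delta ^+ (2 * p) * fine (mu (tail_set delta)) <= moment p.
Proof.
move=> d0; have mB := measurable_tail delta.
have iS := bdmeas_integrable mu (bdmeas_cpurityX (2 * p)).
have sub : tail_set delta `<=` S by move=> x [].
have iB := integrableS (@measurable_sphere R d n) mB sub iS.
rewrite -(Rintegral_cst mu mB).
apply: le_trans (_ : \int[mu]_(x in tail_set delta) re (h x ^+ (2 * p)) <= _).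
  apply: le_Rintegral => //.
    have := bdmeas_integrable mu (@bdmeas_cst R d n (toC (delta ^+ (2 * p)))).
    exact: integrableS (@measurable_sphere R d n) mB sub.
  move=> x [Sx /= hx]; rewrite cpurity_real// -toCX.
  exact: (lerXn2r _ d0 (ltW (le_lt_trans d0 hx)) (ltW hx)).
rewrite /moment /Emean /Rintegral fine_le//.
- exact: (integrable_fin_num mB iB).
- exact: (integrable_fin_num (@measurable_sphere R d n) iS).
apply: ge0_subset_integral => //; first exact: measurable_sphere.
  by case/integrableP : iS.
by move=> x Sx; rewrite lee_fin cpurity_real// -toCX /= exprM exprn_ge0// sqr_ge0.
Qed.

(** The 8 is twice the 4 of [moment_le]: order [p] of the exponential series of [z] then contributes
    at most [2^-p], and the geometric series sums to the prefactor 2. *)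
Lemma tail_le delta : 0 <= delta ->
  fine (mu (tail_set delta)) <= 2 * expR (- (dim1%:R * delta ^+ 2 / 8)).
Proof.
move=> d0; set q := fine _; set z := dim1%:R * delta ^+ 2 / 8.
have D0 : 0 < dim1%:R :> R by rewrite ltr0n /dim1 addn1.
rewrite expRN -ler_pdivrMr ?invr_gt0 ?expR_gt0// invrK.
have q0 : 0 <= q by exact: fine_ge0.
have term p : q * (z ^+ p / p`!%:R) <= 2^-1 ^+ p.
  have k := le_trans (tail_moment p d0) (moment_le p).
  have pf : 0 < p`!%:R :> R by rewrite ltr0n fact_gt0.
  rewrite mulrA ler_pdivrMr// mulrC.
  have -> : z ^+ p = (dim1%:R / 8) ^+ p * delta ^+ (2 * p).
    by rewrite /z exprM -exprMn; congr (_ ^+ p); ring.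
  rewrite -mulrA.
  apply: le_trans (ler_wpM2l _ k) _; first by rewrite exprn_ge0// divr_ge0// ltW.
  rewrite mulrCA -exprMn mulrC (_ : dim1%:R / 8 * (4 / dim1%:R) = 2^-1)//.
  by field; rewrite lt0r_neq0.
have part M : q * series (exp_coeff z) M <= 2.
  rewrite /series /= mulr_sumr.
  apply: le_trans (_ : \sum_(0 <= i < M) 2^-1 ^+ i <= _).
    by apply: ler_sum => p _; exact: term.
  have -> : \sum_(0 <= i < M) 2^-1 ^+ i = 2 - 2 * 2^-1 ^+ M :> R.
    elim: M => [|M IH]; first by rewrite big_geq// expr0 mulr1 subrr.
    by rewrite big_nat_recr//= IH exprS; field.
  by rewrite gerBl mulr_ge0// exprn_ge0// invr_ge0.
have cz := is_cvg_series_exp_coeff z.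
have -> : q * expR z = limn (fun M => q * series (exp_coeff z) M).
  by apply/esym/cvg_lim => //; apply: cvgMl_tmp.
apply: limr_le; first by apply: is_cvgMl_tmp.
by near=> M; exact: part.
Unshelve. all: by end_near. Qed.
End Tail.

(** * Union bound over the subsystems *)

Lemma union_bound (dd : measure_display) (T : measurableType dd) (R : realType)
  (mu : {measure set T -> \bar R}) (I : Type) (r : seq I) (P : pred I) (F : I -> set T) :
  (forall i, measurable (F i)) ->
  (mu (\big[setU/set0]_(i <- r | P i) F i) <= \sum_(i <- r | P i) mu (F i))%E.
Proof.
move=> mF; elim: r => [|i r IH]; first by rewrite !big_nil measure0.
rewrite !big_cons; case: (P i) => //.
apply: le_trans (measureU2 _ _ _) _; first exact: mF.
  by apply: bigsetU_measurable => j _; exact: mF.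
exact: leeD2l.
Qed.

(** The number [c] is the gap between the purity threshold and the mean. On the sphere the purity is
    real, so the complex inequality becomes a real one. *)
Lemma approx_kuniformE (R : realType) (d n k : nat) (eps : R) (psi : ket R d n) (c : R) :
  (forall S0 : {set 'I_n}, #|S0| = k ->
    mean_purity R d S0 = toC ((d ^ k)%:R^-1 + eps ^+ 2 - c)) ->
  approx_kuniform k eps psi <-> @unit_sphere R d n psi /\
    forall S0 : {set 'I_n}, #|S0| = k -> re (cpurity S0 psi) <= c.
Proof.
move=> hm; rewrite /approx_kuniform.
suff e (S0 : {set 'I_n}) : unit_sphere psi -> #|S0| = k ->
   (\tr (reduced S0 (density psi) *m reduced S0 (density psi))
     <= (((d ^ #|S0|)%:R)^-1 + eps ^+ 2)%:C%C :> Cplx R) = (re (cpurity S0 psi) <= c).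
  by split=> -[Sp H]; split=> // S0 kS; have := H S0 kS; rewrite /= e.
move=> Sp kS; rewrite kS purity_tr.
rewrite -(subrK (mean_purity R d S0) (purity _ _)) -/(cpurity S0 psi) cpurity_real// (hm _ kS).
by rewrite /toC -rmorphD lecR; apply/idP/idP => ?; lra.
Qed.

Lemma const_ge8 (R : realType) : 8 <= 72 * pi ^+ 3 * ln 2 :> R.
Proof.
have p2 : 2 <= pi :> R by exact: pi_ge2.
have l2 : 2^-1 <= ln 2 :> R.
  have h : 0 < 2^-1 :> R by rewrite invr_gt0.
  (* [ln (1 + x) <= x] at [x = -1/2] gives [ln 2 >= 1/2]. *)
  have := @le_ln1Dx R (- 2^-1).
  have -> : 1 + - 2^-1 = 2^-1 :> R by field.
  rewrite lnV ?posrE//; lra.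
have p3 : 1 <= pi ^+ 3 :> R by apply: exprn_ege1; lra.
have : 1 * 2^-1 <= pi ^+ 3 * ln 2 :> R by apply: ler_pM => //; lra.
rewrite -mulrA; lra.
Qed.

Theorem theorem2 (R : realType) (d n k : nat) (eps : R)
  (mu : probability (borel_ket R d n) R) :
  (2 <= d)%N -> (1 <= k <= n)%N -> 0 <= eps ->
  haar_state mu ->
  let Delta : R :=
    (d%:R ^+ k + d%:R ^+ (n - k)) / (d%:R ^+ n + 1) - 1 / d%:R ^+ k in
  let delta : R := eps ^+ 2 - Delta in
  2 * Delta <= eps ^+ 2 ->
  ((1 - 'C(n, k)%:R *
      (2 * expR (- (d%:R ^+ n * delta ^+ 2 / (72 * pi ^+ 3 * ln 2)))))%:E
    <= mu [set psi | approx_kuniform k eps psi])%E.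
Proof.
move=> d2 /andP[k1 kn] eps0 haar Delta delta De.
(* With [x = d^k] and [y = d^(n-k)], clearing denominators leaves [x^2 >= 1]. *)
have Dge : 0 <= Delta.
  rewrite /Delta.
  have -> : d%:R ^+ n = d%:R ^+ k * d%:R ^+ (n - k) :> R by rewrite -exprD subnKC.
  have d1 : 1 <= d%:R :> R by rewrite ler1n ltnW.
  have := exprn_ege1 k d1; have := exprn_ege1 (n - k) d1.
  set x := _ ^+ k; set y := _ ^+ _ => y1 x1.
  have x0 : 0 < x by lra.
  have D0 : 0 < x * y + 1 by rewrite addr_gt0// mulr_gt0//; lra.
  rewrite subr_ge0 ler_pdivrMr// mulrAC ler_pdivlMr// mul1r.
  have : 1 * 1 <= x * x by apply: ler_pM.
  lra.
(* The assumption on [eps] gives [delta >= Delta >= 0], the sign that Markov's inequality needs. *)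
have del0 : 0 <= delta by rewrite /delta; lra.
have De8 (S0 : {set 'I_n}) : dim1 d S0 = (d ^ n + 1)%N.
  by rewrite /dim1 card_ord card_split card_comp_basis.
have hm (S0 : {set 'I_n}) : #|S0| = k ->
    mean_purity R d S0 = toC ((d ^ k)%:R^-1 + eps ^+ 2 - delta).
  move=> kS; rewrite mean_purityE De8 card_ord card_sub_basis card_env_basis kS.
  congr toC; rewrite natrD !natrX /delta /Delta; lra.
set q := 2 * expR _.
have tail (S0 : {set 'I_n}) : (mu (tail_set S0 delta) <= q%:E)%E.
  rewrite -[leLHS]fineK ?fin_num_measure//; last exact: measurable_tail.
  rewrite lee_fin; apply: le_trans (tail_le S0 haar del0) _; rewrite /q.
  rewrite ler_pM2l// ler_expR lerN2 De8.
  have c8 := const_ge8 R.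
  rewrite ler_pdivrMr; last by lra.
  apply: le_trans (_ : d%:R ^+ n * delta ^+ 2 / 8 * 8 <= _); first by rewrite divfK.
  have dn : 0 <= d%:R ^+ n * delta ^+ 2 :> R by rewrite mulr_ge0 ?exprn_ge0 ?sqr_ge0.
  apply: ler_pM => //; first by rewrite divr_ge0.
  (* The tail exponent has [d^n + 1], the target only [d^n]. *)
  by rewrite ler_pM2r// ler_wpM2r ?sqr_ge0// natrD natrX lerDl.
pose B : set (borel_ket R d n) :=
  \big[setU/set0]_(S0 : {set 'I_n} | #|S0| == k) (tail_set S0 delta).
have mB : measurable (B : set (borel_ket R d n)).
  by apply: bigsetU_measurable => S0 _; exact: measurable_tail.
have muB : (mu B <= ('C(n, k)%:R * q)%:E)%E.
  apply: le_trans (@union_bound _ _ _ mu _ _ _ (fun S0 : {set 'I_n} => tail_set S0 delta) _) _.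
    by move=> S0; exact: measurable_tail.
  apply: le_trans (_ : \sum_(S0 : {set 'I_n} | #|S0| == k) q%:E <= _)%E.
    by apply: lee_sum => S0 _; exact: tail.
  rewrite sumEFin lee_fin sumr_const mulr_natl.
  have <- : #|[set A : {set 'I_n} | #|A| == k]%SET| = 'C(n, k) by rewrite card_draws card_ord.
  rewrite le_eqVlt; apply/orP; left; apply/eqP; congr (q *+ _).
  by apply: eq_card => S0; rewrite !inE.
have goodE : [set psi | approx_kuniform k eps psi] = @unit_sphere R d n `\` B.
  apply/seteqP; split=> psi /=.
    move=> /(approx_kuniformE _ hm)[Sp H]; split=> //.
    rewrite /B -bigcup_seq_cond => -[S0 /= /andP[_ /eqP kS] [_ /=]].
    by rewrite ltNge H.
  move=> [Sp nB]; apply/(approx_kuniformE _ hm); split=> // S0 kS.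
  rewrite leNgt; apply/negP => lt; apply: nB.
  rewrite /B -bigcup_seq_cond; exists S0 => //=.
  by rewrite mem_index_enum kS eqxx.
have mG : measurable ([set psi | approx_kuniform k eps psi] : set (borel_ket R d n)).
  by rewrite goodE; apply: measurableD => //; exact: measurable_sphere.
(* With [G] the set of good states, what remains is [1 = mu S <= mu (G U B) <= mu G + mu B]. *)
rewrite EFinB leeBlDr//.
apply: le_trans (leeD2l _ muB).
apply: le_trans (measureU2 _ mG mB).
rewrite -[leLHS]haar.1; apply: le_measure; rewrite ?inE//.
- exact: measurable_sphere.
- exact: measurableU.
- by move=> psi Sp; rewrite goodE; have [|] := pselect (B psi); [right|left].
Qed.
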